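(* Let $(L,\leqslant)$ be an infinite linearly ordered set. Then for every natural number $n$ the semigroup $\mathscr{OI}_n(L)$ of partial order isomorphisms of $L$ of rank at most $n$ is stable.
   Context: Natural numbers are positive integers. A partial order isomorphism of a linearly ordered set $(L,\leqslant)$ is an injective partial map $\alpha\colon L\rightharpoonup L$ with domain $\operatorname{dom}\alpha$ and range $\operatorname{ran}\alpha$ such that for all $x_1,x_2\in\operatorname{dom}\alpha$, $x_1\leqslant x_2$ implies $(x_1)\alpha\leqslant(x_2)\alpha$ (the empty partial map $\boldsymbol{0}$ is allowed). Maps are written on the right and composed from left to right: $(x)(\alpha\beta)=((x)\alpha)\beta$, with $\operatorname{dom}(\alpha\beta)=\{y\in\operatorname{dom}\alpha : (y)\alpha\in\operatorname{dom}\beta\}$. For a natural number $n$, $\mathscr{OI}_n(L)$ is the semigroup, under this composition, of all partial order isomorphisms $\alpha$ of $L$ with $|\operatorname{dom}\alpha|\leq n$. A semigroup $S$ is called stable if for all $a,b\in S$: (1) $Sa\subseteq Sab$ implies $Sa=Sab$; and (2) $aS\subseteq baS$ implies $aS=baS$. *)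

(* Defs.v *)
From HB Require Import structures.
From mathcomp Require Import all_boot all_order.
From mathcomp Require Import finmap.
From mathcomp Require Import classical_sets functions cardinality.

Set Implicit Arguments.
Unset Strict Implicit.
Unset Printing Implicit Defensive.

Import Order.TTheory.

Local Open Scope fset_scope.
Local Open Scope fmap_scope.
Local Open Scope order_scope.

Section PartialOrderIsomorphisms.
Context {d : Order.disp_t} {L : orderType d}.
Implicit Types f g h : {fmap L -> L}.

(* f.[? x] is the value of f at x, and None when x is outside domf f; reducef
   keeps the points of domf f whose image has a value under g. *)
Definition compf f g : {fmap L -> L} := reducef [fmap x : domf f => g.[? f x]].

Lemma fnd_compf f g x : (compf f g).[? x] = obind (fnd g) f.[? x].
Proof.
rewrite fnd_reducef; case: fndP => /= [xf|xf]; last by rewrite not_fnd.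
by rewrite ffunE (in_fnd xf).
Qed.

Lemma domf_compf f g :
  domf (compf f g) = [fsetval x : domf f | f x \in domf g].
Proof.
apply/fsetP=> x; rewrite domf_reduce.
apply/imfsetP/imfsetP => -[u /= uP ->]; exists u => //; move: uP;
  by rewrite !inE ffunE; case: fndP.
Qed.

Definition partial_order_iso f : bool :=
  injectiveb f &&
  [forall x1 : domf f, [forall x2 : domf f,
    (val x1 <= val x2) ==> (f x1 <= f x2)]].

Lemma partial_order_isoP f :
  reflect (injective f /\
           forall x1 x2 : domf f, val x1 <= val x2 -> f x1 <= f x2)
          (partial_order_iso f).
Proof.
apply: (iffP andP) => -[/injectiveP fI fM]; split=> //.
  by move=> x1 x2; move/forallP: fM => /(_ x1)/forallP/(_ x2)/implyP.
by apply/forallP=> x1; apply/forallP=> x2; apply/implyP/fM.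
Qed.

Lemma compfA : associative compf.
Proof.
move=> f g h; apply/fmapP=> x; rewrite !fnd_compf.
by case: (f.[? x]) => //= y; rewrite fnd_compf.
Qed.

Lemma card_compf f g : (#|` domf (compf f g)| <= #|` domf f|)%N.
Proof.
by apply: fsubset_leq_card; rewrite domf_compf; apply/fsubsetP=> x
  /imfsetP[u _ ->]; apply: valP.
Qed.

Lemma compfE f g (x : domf (compf f g)) :
  exists (u : domf f) (v : domf g),
    [/\ val u = val x, val v = f u & compf f g x = g v].
Proof.
have := fnd_compf f g (val x); rewrite -Some_fnd.
case: (fndP f (val x)) => //= xf; case: fndP => //= yg [->].
by exists [` xf], [` yg].
Qed.

Lemma partial_order_iso_compf f g :
  partial_order_iso f -> partial_order_iso g ->
  partial_order_iso (compf f g).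
Proof.
move=> /partial_order_isoP[fI fM] /partial_order_isoP[gI gM].
apply/partial_order_isoP; split=> x1 x2;
  have [u1 [v1 [ux1 vu1 ->]]] := compfE x1;
  have [u2 [v2 [ux2 vu2 ->]]] := compfE x2.
- move=> /gI v12; apply: val_inj; rewrite /= -ux1 -ux2; congr val.
  by apply: fI; rewrite -vu1 -vu2 v12.
- by rewrite -ux1 -ux2 => /fM; rewrite -vu1 -vu2 => /gM.
Qed.

End PartialOrderIsomorphisms.

Record OI {d : Order.disp_t} (L : orderType d) (n : nat) : Type := MkOI {
  OI_val :> {fmap L -> L};
  _ : partial_order_iso OI_val && (#|` domf OI_val| <= n)%N
}.

HB.instance Definition _ d (L : orderType d) n := [isSub for @OI_val d L n].
HB.instance Definition _ d (L : orderType d) n := [Choice of OI L n by <:].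

Section OISemigroup.
Context {d : Order.disp_t} {L : orderType d} {n : nat}.
Implicit Types a b : OI L n.

Lemma OI_mul_subproof a b :
  partial_order_iso (compf a b) && (#|` domf (compf a b)| <= n)%N.
Proof.
have /andP[aP an] := valP a; have /andP[bP _] := valP b.
by rewrite partial_order_iso_compf //= (leq_trans (card_compf _ _)).
Qed.

(* Maps act on the right: in a * b, the map a is applied first. *)
Definition OI_mul a b : OI L n := MkOI (OI_mul_subproof a b).

Lemma OI_mulA : associative OI_mul.
Proof. by move=> a b c; apply: val_inj; apply: compfA. Qed.

HB.instance Definition _ := isSemigroup.Build (OI L n) OI_mulA.

End OISemigroup.

Local Open Scope classical_set_scope.
Local Open Scope group_scope.

Section Stability.
Variable S : semigroupType.
Implicit Types a b : S.

(* Sa and aS in the semigroup S itself, with no identity adjoined. *)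
Definition left_multiples a : set S := [set s * a | s in [set: S]].
Definition right_multiples a : set S := [set a * s | s in [set: S]].

Definition stable_semigroup : Prop :=
  forall a b,
    (left_multiples a `<=` left_multiples (a * b) ->
     left_multiples a = left_multiples (a * b)) /\
    (right_multiples a `<=` right_multiples (b * a) ->
     right_multiples a = right_multiples (b * a)).

End Stability.

(* Main.v *)
Require Import Defs.
From mathcomp Require Import all_boot all_order.
From mathcomp Require Import finmap.
From mathcomp Require Import classical_sets functions cardinality.

(** A finite chain is rigid: an order-preserving injection of a finite set [D]
    into itself is the identity, since a point moved downwards (or upwards)
    would start an infinite strictly monotone orbit in [D]
    ([homo_stable_not_rel], [partial_order_iso_stable_id]).

    Each [a] is a left and a right multiple of itself by the identity maps of
    its domain and of its range, so [Sa] included in [Sab] yields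
    [a = s * (a * b)] for some [s].  Then [s] carries [dom a] into itself, hence
    is the identity there, and [x a = ((x s) a) b = (x a) b] on [dom a], that is
    [a * b = a] ([compf_right_absorb]).  Dually, [aS] included in [baS] yields
    [a = (b * a) * s], so [b] carries [dom a] into itself, hence is the identity
    there, and no other point is sent by the injective [b] into [dom a]:
    [b * a = a] ([compf_left_absorb]).  In both cases the two sets of multiples are
    equal because the two elements are. *)

Set Implicit Arguments.
Unset Strict Implicit.
Unset Printing Implicit Defensive.

Import Order.TTheory.

Local Open Scope fset_scope.
Local Open Scope fmap_scope.
Local Open Scope order_scope.
Local Open Scope group_scope.
Local Open Scope classical_set_scope.

(** Infinite descent along the orbit [x], [f x], [f (f x)]...: the number of
    elements of [D] related to the current point decreases strictly.  Stated for
    an arbitrary strict order so as to serve for both [<] and its converse. *)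
Lemma homo_stable_not_rel (T : choiceType) (r : rel T) (D : {fset T})
    (f : T -> T) :
  irreflexive r -> transitive r ->
  (forall x, x \in D -> f x \in D) ->
  {in D &, {homo f : x y / r x y}} ->
  forall x, x \in D -> ~~ r (f x) x.
Proof.
move=> r_irr r_tr fD f_homo x.
have [m] := ubnP #|` [fset y in D | r y x]|.
elim: m x => // m IHm x; rewrite ltnS => le_m xD; apply/negP=> r_fx_x.
have /negP[] : ~~ r (f (f x)) (f x); last by apply: f_homo => //; apply: fD.
apply: IHm (fD _ xD); apply: leq_trans le_m; apply: fproper_ltn_card.
rewrite fproperE; apply/andP; split.
  by apply/fsubsetP=> y; rewrite !inE => /andP[-> /r_tr ->].
by apply/fsubsetPn; exists (f x); rewrite !inE fD //= r_irr.
Qed.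

Section PartialMaps.
Context {d : Order.disp_t} {L : orderType d}.
Implicit Types (f g s : {fmap L -> L}) (A D : {fset L}).

Lemma partial_order_iso_inj f x1 x2 y :
  partial_order_iso f -> f.[? x1] = Some y -> f.[? x2] = Some y -> x1 = x2.
Proof.
move=> /partial_order_isoP[fI _].
case: fndP => // x1f [<-]; case: fndP => // x2f [/fI].
by move/(congr1 val).
Qed.

Lemma partial_order_iso_lt f x1 x2 y1 y2 :
  partial_order_iso f -> f.[? x1] = Some y1 -> f.[? x2] = Some y2 ->
  x1 < x2 -> y1 < y2.
Proof.
move=> fP f1 f2 lt12; rewrite lt_neqAle; apply/andP; split.
  apply: contraTneq lt12 => y12; rewrite -y12 in f2.
  by rewrite (partial_order_iso_inj fP f1 f2) ltxx.
have /partial_order_isoP[_ fM] := fP; move: f1 f2.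
case: fndP => // x1f [<-]; case: fndP => // x2f [<-].
by apply: fM; apply: ltW.
Qed.

(** Rigidity of finite chains: no point of [D] moves down, by descent along [<],
    and none moves up, by descent along [>]. *)
Lemma partial_order_iso_stable_id f D :
  partial_order_iso f ->
  (forall x, x \in D -> exists2 y, y \in D & f.[? x] = Some y) ->
  forall x, x \in D -> f.[? x] = Some x.
Proof.
move=> fP fD x xD.
(* the total extension of f fixing the points outside its domain *)
pose g x := odflt x f.[? x].
have gE z : z \in D -> f.[? z] = Some (g z).
  by move=> /fD[y _ fz]; rewrite /g fz.
have gD z : z \in D -> g z \in D.
  by move=> zD; have [y yD fz] := fD _ zD; rewrite /g fz.
have g_lt : {in D &, {homo g : y z / y < z}}.
  by move=> y z yD zD; apply: (partial_order_iso_lt fP); apply: gE.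
have g_gt : {in D &, {homo g : y z / z < y}} by move=> y z yD zD; apply: g_lt.
rewrite gE //; congr Some; apply/eqP; rewrite eq_le !leNgt.
rewrite (homo_stable_not_rel ltxx lt_trans gD g_lt) //.
rewrite (homo_stable_not_rel _ _ gD g_gt) //.
by move=> u v w lt_uv lt_wu; apply: lt_trans lt_wu lt_uv.
Qed.

Definition idf A : {fmap L -> L} := [fmap x : A => val x].

Lemma fnd_idf A x : (idf A).[? x] = if x \in A then Some x else None.
Proof. by case: fndP => //= xA; rewrite ffunE. Qed.

Lemma partial_order_iso_idf A : partial_order_iso (idf A).
Proof.
apply/partial_order_isoP; split=> x1 x2; rewrite !ffunE //.
exact: val_inj.
Qed.

Lemma compf_idl f : compf (idf (domf f)) f = f.
Proof.
apply/fmapP=> x; rewrite fnd_compf fnd_idf.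
by case: ifPn => //= xf; rewrite not_fnd.
Qed.

Lemma compf_idr f : compf f (idf (codomf f)) = f.
Proof.
apply/fmapP=> x; rewrite fnd_compf.
by case: fndP => //= xf; rewrite fnd_idf in_codomf.
Qed.

Lemma card_codomf f : (#|` codomf f| <= #|` domf f|)%N.
Proof.
apply: leq_trans (leq_imfset_card _ _ _) _; rewrite cardfE cardE.
apply: uniq_leq_size; first exact: enum_finmem_uniq.
by move=> u _; rewrite mem_enum.
Qed.

(** Here [s] maps the domain of [f] into itself, so it fixes it pointwise, and
    [(x s) f g] is [x f g]. *)
Lemma compf_right_absorb f g s :
  partial_order_iso s -> f = compf s (compf f g) -> compf f g = f.
Proof.
move=> sP fE.
have fEx x : f.[? x] = (compf s (compf f g)).[? x] by rewrite -fE.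
have s_id : forall x, x \in domf f -> s.[? x] = Some x.
  apply: partial_order_iso_stable_id => // x xf.
  have := fEx x; rewrite (in_fnd xf) fnd_compf.
  case: (s.[? x]) => //= y; rewrite fnd_compf.
  by case: (fndP f y) => // yf _; exists y.
apply/fmapP=> x; have [xf|xf] := boolP (x \in domf f).
  by rewrite [RHS]fEx [RHS]fnd_compf s_id.
by rewrite fnd_compf not_fnd.
Qed.

(** Here [g] maps the domain of [f] into itself, so it fixes it pointwise; being
    injective, it sends no further point there. *)
Lemma compf_left_absorb f g s :
  partial_order_iso g -> f = compf (compf g f) s -> compf g f = f.
Proof.
move=> gP fE.
have fEx x : f.[? x] = (compf (compf g f) s).[? x] by rewrite -fE.
have g_id : forall x, x \in domf f -> g.[? x] = Some x.
  apply: partial_order_iso_stable_id => // x xf.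
  have := fEx x; rewrite (in_fnd xf) !fnd_compf.
  case: (g.[? x]) => //= y.
  by case: (fndP f y) => // yf _; exists y.
apply/fmapP=> x; rewrite fnd_compf.
have [xf|xf] := boolP (x \in domf f); first by rewrite g_id.
rewrite [RHS]not_fnd //; case gx: (g.[? x]) => [y|] //=.
apply: not_fnd; apply: contra xf => yf.
by rewrite (partial_order_iso_inj gP gx (g_id y yf)).
Qed.

End PartialMaps.

Section Rank.
Context {d : Order.disp_t} {L : orderType d} {n : nat}.
Implicit Types (a b s : OI L n) (A : {fset L}).

Lemma OI_partial_order_iso a : partial_order_iso a.
Proof. by have /andP[] := valP a. Qed.

Lemma OI_rank a : (#|` domf (OI_val a)| <= n)%N.
Proof. by have /andP[] := valP a. Qed.

Lemma OI_idf A : (#|` A| <= n)%N -> exists e : OI L n, OI_val e = idf A.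
Proof.
move=> An; have eP : partial_order_iso (idf A) && (#|` domf (idf A)| <= n)%N.
  by rewrite partial_order_iso_idf.
by exists (MkOI eP).
Qed.

Lemma left_multiples_refl a : left_multiples a a.
Proof.
have [e eE] := OI_idf (OI_rank a).
by exists e => //; apply: val_inj; rewrite /= eE compf_idl.
Qed.

Lemma right_multiples_refl a : right_multiples a a.
Proof.
have [e eE] := OI_idf (leq_trans (card_codomf (OI_val a)) (OI_rank a)).
by exists e => //; apply: val_inj; rewrite /= eE compf_idr.
Qed.

Lemma mul_right_absorb a b s : a = s * (a * b) -> a * b = a.
Proof.
move=> /(congr1 val) aE; apply: val_inj.
exact: compf_right_absorb (OI_partial_order_iso s) aE.
Qed.

Lemma mul_left_absorb a b s : a = b * a * s -> b * a = a.
Proof.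
move=> /(congr1 val) aE; apply: val_inj.
exact: compf_left_absorb (OI_partial_order_iso b) aE.
Qed.

End Rank.

Theorem mainTheorem1 (d : Order.disp_t) (L : orderType d)
  (L_infinite : infinite_set [set: L]) (n : nat) (n_gt0 : (0 < n)%N) :
  stable_semigroup (OI L n).
Proof.
move=> a b; split=> [/(_ a (left_multiples_refl a))|].
  by case=> s _ /esym/mul_right_absorb ->.
by move=> /(_ a (right_multiples_refl a)) [s _ /esym/mul_left_absorb ->].
Qed.
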